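(* Let $G$ be a finite nonsolvable group. If $G\in\mathcal{D}_4$, then $G\cong\mathrm{A}_5$.
   Context: $\mathcal{D}(G)$ denotes the number of conjugacy classes of nontrivial subgroups $H$ of the finite group $G$ with $N_G(H)\neq H$; $\mathcal{D}_n$ is the family of finite groups $G$ with $\mathcal{D}(G)=n$. *)

(* Defs.v *)
From mathcomp Require Import all_boot all_fingroup all_solvable.
Set Implicit Arguments. Unset Strict Implicit. Unset Printing Implicit Defensive.

Local Open Scope group_scope.

Definition nonselfnorm_subgroups (gT : finGroupType) (G : {group gT})
  : {set {group gT}} :=
  [set H : {group gT} | [&& H \subset G, H != 1 :> {set gT}
                          & 'N_G(H) != H :> {set gT}]].

Definition D_count (gT : finGroupType) (G : {group gT}) : nat :=
  #|[set (gval H :^: G) | H in nonselfnorm_subgroups G]|.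

(* Main.v *)
Require Import Defs.
From mathcomp Require Import all_boot all_fingroup all_solvable.
From mathcomp Require Import ssralg integral_char.

(** If the normalizer of a Sylow subgroup centralized it, Burnside's transfer
    theorem would give a normal complement K; K itself, one subgroup for each of
    its at least three prime divisors, and a Sylow subgroup of K of non-prime
    order (there is one, since groups with cyclic Sylow subgroups are solvable)
    would make five classes.  Hence subgroups of order t or t^2, t prime, are
    never self-normalizing.  Let p be the least prime divisor of the order.  Its
    Sylow subgroup S is not cyclic, so p, p^2 and two further primes q, r are
    the only orders of non-self-normalizing subgroups, with one class each.
    Fusion in S then gives |S| = p^2, so the order is p^2 q r, and N(S) permutes
    transitively the p + 1 subgroups of order p of S; this forces p = 2 and,
    say, q = 3.  Counting Sylow r-subgroups gives r = 5, and N(S) has index 5 in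
    a simple group of order 60. *)

Set Implicit Arguments.
Unset Strict Implicit.
Unset Printing Implicit Defensive.
Local Open Scope group_scope.


(* [A] is any set so that the lemma applies both to subgroups and, with
   [A = [set x]], to elements. *)
Lemma Sylow_fusion (gT : finGroupType) p (G S : {group gT}) (A : {set gT}) g :
    p.-Sylow(G) S -> g \in G -> S \subset 'N(A) -> S \subset 'N(A :^ g) ->
  exists2 n, n \in 'N_G(S) & A :^ n = A :^ g.
Proof.
move=> sylS Gg nAS nAgS; set M := 'N_G(A :^ g)%G.
have sSG := pHall_sub sylS.
have sylM (T : {group gT}) : p.-Sylow(G) T -> T \subset 'N(A :^ g) ->
    p.-Sylow(M) T.
  move=> sylT nT; apply: pHall_subl (sylT); last exact: subsetIl.
  by rewrite subsetI (pHall_sub sylT).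
have sylSg : p.-Sylow(M) (S :^ g)%G.
  by apply: sylM; rewrite ?pHallJ //= normJ conjSg.
(* Both [S :^ g] and [S] are Sylow in the stabilizer [M] of [A :^ g]; multiplying [g] by [m] brings
   [S] back to itself and leaves [A :^ g] alone. *)
have [m /setIP[Gm /normP nAm] defS] := Sylow_trans sylSg (sylM S sylS nAgS).
exists (g * m); last by rewrite conjsgM nAm.
by rewrite inE groupM //=; apply/normP; rewrite conjsgM -defS.
Qed.

(** * Burnside's normal complement theorem, by transfer *)

Section BurnsideComplement.

Variables (gT : finGroupType) (p : nat) (G S : {group gT}).
Hypotheses (sylS : p.-Sylow(G) S) (cNS : 'N_G(S) \subset 'C(S)).

Let sSG : S \subset G := pHall_sub sylS.

Lemma central_Sylow_abelian : abelian S.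
Proof. by apply: subset_trans cNS; rewrite subsetI sSG normG. Qed.

(** Fusion for [[set x]], which the abelian group [S] normalizes: the conjugating element may be
    taken in ['N_G(S)], hence centralizes [x]. *)
Lemma central_Sylow_conj x g : x \in S -> g \in G -> x ^ g \in S -> x ^ g = x.
Proof.
move=> Sx Gg Sxg; have cSS := central_Sylow_abelian.
have cent1 y : y \in S -> S \subset 'N([set y]).
  by move=> Sy; apply/subsetP=> s Ss; apply: (subsetP (cent_sub _));
     rewrite cent_set1; apply/cent1P; apply: (centsP cSS).
have [|n Nn] := Sylow_fusion (A := [set x]) sylS Gg (cent1 x Sx).
  by rewrite conjg_set1 cent1.
rewrite !conjg_set1 => /set1_inj <-.
by rewrite /conjg -(centP (subsetP cNS _ Nn)) // mulKg.
Qed.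

Let abA : abelian (idm S @* S).
Proof. by rewrite im_idm central_Sylow_abelian. Qed.

(** Each cycle of [x] on the right cosets contributes a conjugate, lying in [S], of the power of [x]
    given by its length. By [central_Sylow_conj] this is that power itself, and the lengths add up
    to the index. *)
Lemma transfer_central_Sylow x : x \in S ->
  transfer G abA x = FiniteModule.fmod abA (x ^+ #|G : S|).
Proof.
move=> Sx; have Gx := subsetP sSG x Sx.
have partx := rcosets_cycle_partition sSG Gx.
have trX := transversalP partx.
rewrite (transfer_cycle_expansion sSG abA Gx trX).
rewrite -(sum_index_rcosets_cycle sSG Gx trX).
have fX n : FiniteModule.fmod abA (x ^+ n) =
            (FiniteModule.fmod abA x *+ n)%R.
  by apply: FiniteModule.fmodX; rewrite /= im_idm.
rewrite fX -GRing.sumrMnr; apply: eq_bigr => y Xy.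
have Gy : y \in G := subsetP (transversal_sub trX) y Xy.
rewrite -fX /=; congr (FiniteModule.fmod _ _).
have := mulg_exp_card_rcosets S x y; rewrite mem_rcoset => Sn.
by rewrite central_Sylow_conj ?groupX ?groupV // conjgE invgK mulgA.
Qed.

(** The complement is the kernel of the transfer: on [S] the transfer is a power map with exponent
    prime to [#|S|], hence injective, and its image is a [p]-group. *)
Theorem Burnside_normal_complement :
  exists2 K : {group gT}, K <| G & p^'.-Hall(G) K.
Proof.
pose v x := FiniteModule.fmval (transfer G abA x).
have vM : {in G &, {morph v : x y / x * y}}.
  by move=> x y Gx Gy; rewrite /v transferM.
pose V := Morphism vM; exists ('ker V)%G; first exact: ker_normal.
have tiSK : S :&: 'ker V = 1.
  apply/trivgP/subsetP=> x /setIP[Sx kx]; apply/set1P.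
  have: v x = 1 by apply: (@mker _ _ _ V).
  have Sxn : x ^+ #|G : S| \in idm S @* S by rewrite im_idm groupX.
  rewrite /v transfer_central_Sylow // [LHS](FiniteModule.fmodK abA Sxn) => xn1.
  have coSn : coprime #|S| #|G : S|.
    rewrite coprime_sym; case/and3P: sylS => _ pS p'i.
    exact: p'nat_coprime p'i pS.
  by rewrite -(expgK coSn Sx) xn1 expg1n.
rewrite /pHall subsetIl /=; apply/andP; split.
  have := Sylow_setI_normal (ker_normal V) sylS.
  rewrite setIC tiSK => /pHallP[_ /esym/eqP].
  by rewrite cards1 partn_eq1 ?cardG_gt0.
have pV : p.-group (V @* G).
  apply: pgroupS (pHall_pgroup sylS).
  apply/subsetP=> _ /morphimP[x _ Gx ->] /=.
  by have := FiniteModule.fmodP (transfer G abA x); rewrite /= im_idm.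
by move: pV; rewrite pnatNK /pgroup card_morphim setIid.
Qed.

End BurnsideComplement.

(** * Cyclic Sylow subgroups and solvability *)

(** A prime [q] dividing the order of the automorphism group induced by ['N_G(S)] is at least [p]
    and divides the totient of a power of [p], so [q = p]. But [S] is abelian and acts trivially on
    itself, so that order is prime to [p]. *)
Lemma cyclic_Sylow_pdiv_central (gT : finGroupType) (G S : {group gT}) :
  (pdiv #|G|).-Sylow(G) S -> cyclic S -> 'N_G(S) \subset 'C(S).
Proof.
set p := pdiv _ => sylS cycS; have [sSG pS p'i] := and3P sylS.
have [-> | ntS] := eqsVneq S 1; first by rewrite cent1T subsetT.
have [p_pr p_dv_S [k cardS]] := pgroup_pdiv pS ntS.
set N := 'N_G(S)%G; have sSN : S \subset N by rewrite subsetI sSG normG.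
have sNN : N \subset 'N(S) := subsetIr _ _.
suff I1 : conj_aut S @* N = 1.
  by rewrite -(ker_conj_aut S) -sub_morphim_pre // I1.
apply/eqP; case: (trivgVpdiv (conj_aut S @* N)%G) => [/= -> // | [q q_pr q_dv_I]].
have q_dv_N : q %| #|N| := dvdn_trans q_dv_I (dvdn_morphim _ _).
have le_pq : p <= q.
  apply: pdiv_min_dvd (prime_gt1 q_pr) (dvdn_trans q_dv_N _).
  by rewrite cardSg ?subsetIl.
have: q %| totient #|S|.
  rewrite -(card_Aut_cyclic cycS); apply: dvdn_trans q_dv_I _.
  by rewrite cardSg ?Aut_conj_aut.
rewrite cardS totient_pfactor // Euclid_dvdM // => /orP[q_dv_p1 | ].
  have p1_gt0 : 0 < p.-1 by rewrite -subn1 subn_gt0 prime_gt1.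
  have := leq_trans le_pq (dvdn_leq p1_gt0 q_dv_p1).
  by rewrite leqNgt prednK ?leqnn ?prime_gt0.
rewrite Euclid_dvdX // dvdn_prime2 // => /andP[/eqP def_q _].
have: p^'.-nat #|conj_aut S @* N|.
  rewrite card_morphim ker_conj_aut (setIidPr sNN).
  apply: pnat_dvd p'i; apply: (dvdn_trans (indexgS _ (_ : S \subset 'C(S)))).
    exact: cyclic_abelian.
  by rewrite -(dvdn_pmul2l (cardG_gt0 S)) !Lagrange // cardSg ?subsetIl.
by rewrite p'natE // -def_q q_dv_I.
Qed.

Lemma Zgroup_logn (gT : finGroupType) (G : {group gT}) :
  (forall q, prime q -> logn q #|G| <= 1) -> Zgroup G.
Proof.
move=> le1; apply/forall_inP=> V /SylowP[q q_pr sylV].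
have := card_Hall sylV; rewrite p_part; case: logn (le1 q q_pr) => [|[]] // _.
  by move/card1_trivg->; apply: cyclic1.
by move=> cV; apply: prime_cyclic; rewrite cV expn1.
Qed.

Lemma sol_p_complement (gT : finGroupType) (p : nat) (G K : {group gT}) :
  K <| G -> p^'.-Hall(G) K -> solvable K -> solvable G.
Proof.
move=> nsKG /and3P[_ _ pi] solK; rewrite (series_sol nsKG) solK /=.
apply: (@pgroup_sol _ p); rewrite /pgroup card_quotient ?normal_norm //.
by rewrite -pnatNK.
Qed.

(** Induction on the order: the least prime divisor yields a proper normal complement, again with
    cyclic Sylow subgroups. *)
Lemma Zgroup_sol (gT : finGroupType) (G : {group gT}) : Zgroup G -> solvable G.
Proof.
have [n] := ubnP #|G|; elim: n G => // n IHn G /ltnSE-leGn ZgG.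
have [-> | ntG] := eqsVneq G 1; first exact: solvable1.
have p_pr : prime (pdiv #|G|) by rewrite pdiv_prime ?cardG_gt1.
have [S sylS] := Sylow_exists (pdiv #|G|) G.
have cycS : cyclic S by apply: (forall_inP ZgG); apply: p_Sylow sylS.
have [K nsKG hallK] :=
  Burnside_normal_complement sylS (cyclic_Sylow_pdiv_central sylS cycS).
apply: (sol_p_complement nsKG hallK); apply: IHn; last first.
  exact: ZgroupS (normal_sub nsKG) ZgG.
apply: leq_trans leGn; apply: proper_card; rewrite properEneq normal_sub // andbT.
apply: contraTneq (pHall_pgroup hallK) => ->.
by rewrite /pgroup p'natE // pdiv_dvd.
Qed.

(** * Counting classes through the orders of subgroups *)

Section Counting.

Variables (gT : finGroupType) (G : {group gT}).
Local Notation nsn := (nonselfnorm_subgroups G).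

Definition nsn_order (n : nat) := [exists H in nsn, #|gval H| == n].

Lemma nsn_orderP n : reflect (exists2 H : {group gT}, H \in nsn & #|H| = n)
                             (nsn_order n).
Proof.
by apply: (iffP exists_inP) => [] [H nH] /eqP; exists H => //; apply/eqP.
Qed.

Let cls := [set gval H :^: G | H in nsn].
(** All members of a class have the same order; the maximum is a way to read it off the class. *)
Let ord (c : {set {set gT}}) := \max_(A in c) #|A|.

Let ordE (H : {group gT}) : ord (H :^: G) = #|H|.
Proof.
apply/eqP; rewrite eqn_leq; apply/andP; split.
  by apply/bigmax_leqP=> _ /imsetP[x _ ->]; rewrite cardJg.
apply: (@leq_bigmax_cond _ _ (fun A : {set gT} => #|A|) (H : {set gT})).
by apply/imsetP; exists 1; rewrite ?group1 ?conjsg1.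
Qed.

Let mem_cls H : H \in nsn -> gval H :^: G \in cls.
Proof. exact: (imset_f (fun K : {group gT} => gval K :^: G)). Qed.

Let cls_orders s : all nsn_order s -> {subset s <= map ord (enum cls)}.
Proof.
move/allP=> ns n /ns /nsn_orderP[H nH <-]; apply/mapP; exists (gval H :^: G).
  by rewrite mem_enum mem_cls.
by rewrite ordE.
Qed.

(** Conjugate subgroups have equal orders, so distinct orders come from distinct classes. *)
Lemma leq_D_count s : uniq s -> all nsn_order s -> size s <= D_count G.
Proof.
move=> Us /cls_orders/(uniq_leq_size Us).
by rewrite size_map -cardE.
Qed.

(** When [s] has as many entries as there are classes, no class is left over for another order. *)
Lemma D_count_orders s H : uniq s -> all nsn_order s -> D_count G <= size s ->
  H \in nsn -> #|H| \in s.
Proof.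
move=> Us ns le_s nH; rewrite /D_count cardE -(size_map ord) in le_s.
have [_ ->] := uniq_min_size Us (cls_orders ns) le_s.
by apply/mapP; exists (gval H :^: G); rewrite ?ordE // mem_enum mem_cls.
Qed.

(** The same tight count makes the order injective on classes. *)
Lemma D_count_conj s (H K : {group gT}) :
    uniq s -> all nsn_order s -> D_count G <= size s ->
  H \in nsn -> K \in nsn -> #|H| = #|K| -> exists2 x, x \in G & K :=: H :^ x.
Proof.
move=> Us ns le_s nH nK eqHK; rewrite /D_count cardE -(size_map ord) in le_s.
have inj_ord : {in cls &, injective ord}.
  by apply/dinjectiveP; apply: leq_size_uniq Us (cls_orders ns) le_s.
have /imsetP[x Gx ->] : gval K \in gval H :^: G; last by exists x.
have -> : gval H :^: G = gval K :^: G.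
  by apply: inj_ord; rewrite ?mem_cls ?ordE.
by apply/imsetP; exists 1; rewrite ?group1 ?conjsg1.
Qed.

Lemma normal_nsn (K : {group gT}) : K <| G -> K :!=: 1 -> K :!=: G -> K \in nsn.
Proof.
case/andP=> sKG nKG ntK; rewrite !inE sKG ntK (setIidPl nKG) eq_sym //.
Qed.

(** A [p]-subgroup that is Sylow in its normalizer is Sylow in [G]. *)
Lemma pgroup_nsn (p : nat) (H : {group gT}) : H \subset G -> p.-group H ->
  H :!=: 1 -> ~~ p.-Sylow(G) H -> H \in nsn.
Proof.
move=> sHG pH ntH; rewrite !inE sHG ntH /=; apply: contra => /eqP defH.
by rewrite -Sylow_subnorm defH /pHall subxx indexgg pH.
Qed.

End Counting.

(** * Orders forced to occur when there are four classes *)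

Section SmallCount.

Variables (gT : finGroupType) (G : {group gT}).
Hypotheses (nsolG : ~~ solvable G) (D4 : D_count G = 4).
Local Notation nsn := (nonselfnorm_subgroups G).

(** Only a Sylow subgroup [H] could be self-normalizing, and then the Frattini argument would give
    [G = K 'N_G(H) = K]. *)
Lemma normal_pgroup_nsn (K H : {group gT}) (q : nat) :
    K <| G -> K :!=: G -> H \subset K -> q.-group H -> H :!=: 1 -> H \in nsn.
Proof.
move=> nsKG neqKG sHK qH ntH; have sKG := normal_sub nsKG.
have sHG := subset_trans sHK sKG.
have [sylH | /pgroup_nsn-> //] := boolP (q.-Sylow(G) H).
rewrite !inE sHG ntH /=; apply: contra neqKG => /eqP nH.
have := Frattini_arg nsKG (pHall_subl sHK sKG sylH).
by rewrite nH (mulGSid sHK) => ->.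
Qed.

Lemma Sylow_norm_not_central p (S : {group gT}) :
  prime p -> p %| #|G| -> p.-Sylow(G) S -> ~~ ('N_G(S) \subset 'C(S)).
Proof.
move=> p_pr p_dv_G sylS; apply: contra nsolG => cNS.
have [K nsKG hallK] := Burnside_normal_complement sylS cNS.
apply: (sol_p_complement nsKG hallK).
have neqKG : K :!=: G.
  apply: contraTneq (pHall_pgroup hallK) => ->.
  by rewrite /pgroup p'natE // p_dv_G.
have [/Burnside_p_a_q_b // | gt2] := leqP (size (primes #|K|)) 2.
apply/Zgroup_sol/Zgroup_logn=> q q_pr; rewrite leqNgt; apply/negP=> lt1.
set e := logn q #|K| in lt1.
have qe_npr : ~~ prime (q ^ e).
  apply/negP=> pr_qe; have := dvdn_exp (ltnW lt1) (dvdnn q).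
  rewrite dvdn_prime2 // -{1}(expn1 q) eqn_exp2l ?prime_gt1 // => /eqP e1.
  by rewrite -e1 in lt1.
have K_npr : ~~ prime #|K|.
  by apply/negP=> /primes_prime eK; rewrite eK in gt2.
have ntK : K :!=: 1.
  by apply/eqP=> K1; rewrite K1 cards1 in gt2.
have K_qe : #|K| != (q ^ e)%N.
  apply/eqP=> cK; rewrite cK primesX ?(ltnW lt1) // primes_prime // in gt2.
(* At least five orders: [K], a Sylow [q]-subgroup of [K], and one for each of three or more
   primes. *)
have ltD : size [:: #|K|, (q ^ e)%N & primes #|K|] <= D_count G.
  apply: leq_D_count => /=.
    rewrite inE negb_or K_qe !mem_primes (negPf K_npr) (negPf qe_npr) /=.
    exact: primes_uniq.
  apply/and3P; split.
  - by apply/nsn_orderP; exists K; first exact: normal_nsn.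
  - have [Q sylQ] := Sylow_exists q K; have cQ := card_Hall sylQ.
    rewrite p_part -/e in cQ; apply/nsn_orderP; exists Q => //.
    apply: normal_pgroup_nsn nsKG neqKG (pHall_sub sylQ) (pHall_pgroup sylQ) _.
    by rewrite -cardG_gt1 cQ -{1}(expn0 q) ltn_exp2l ?prime_gt1 ?(ltnW lt1).
  apply/allP=> t; rewrite mem_primes => /and3P[t_pr _ /(Cauchy t_pr)[x Kx ox]].
  apply/nsn_orderP; exists <[x]>%G => //.
  apply: (normal_pgroup_nsn (q := t) nsKG neqKG); rewrite ?cycle_subG //.
    by rewrite /pgroup -orderE ox pnat_id.
  by rewrite -cardG_gt1 -orderE ox prime_gt1.
by move: ltD; rewrite D4 /= !ltnS leqNgt gt2.
Qed.

(* Commutativity of groups of order at most p^2 rules out a self-normalizing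
   Sylow subgroup, by transfer. *)
Lemma nsn_order_small_pgroup p i : prime p -> 0 < i <= 2 -> p ^ i %| #|G| ->
  nsn_order G (p ^ i).
Proof.
move=> p_pr /andP[i_gt0 le_i2] pi_dv_G.
have [S sylS] := Sylow_exists p G; have [sSG pS _] := and3P sylS.
have le_i : i <= logn p #|S|.
  by rewrite (card_Hall sylS) logn_part -pfactor_dvdn.
have [Q [sQS _ cQ]] := normal_pgroup pS (normal_refl S) le_i.
apply/nsn_orderP; exists Q => //.
have sQG := subset_trans sQS sSG; have pQ := pgroupS sQS pS.
have ntQ : Q :!=: 1.
  by rewrite -cardG_gt1 cQ -{1}(expn0 p) ltn_exp2l ?prime_gt1.
have [sylQ | /pgroup_nsn-> //] := boolP (p.-Sylow(G) Q).
have cQQ : abelian Q by apply: (p2group_abelian pQ); rewrite cQ pfactorK.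
have p_dv_G : p %| #|G| by apply: dvdn_trans pi_dv_G; apply: dvdn_exp.
rewrite !inE sQG ntQ; apply: contra (Sylow_norm_not_central p_pr p_dv_G sylQ).
by move/eqP->.
Qed.

Lemma nsn_order_pgroup_proper p i : prime p -> 0 < i -> p ^ i.+1 %| #|G| ->
  nsn_order G (p ^ i).
Proof.
move=> p_pr i_gt0 pi_dv_G.
have [S sylS] := Sylow_exists p G; have [sSG pS _] := and3P sylS.
have lt_i : i < logn p #|S|.
  by rewrite (card_Hall sylS) logn_part -pfactor_dvdn.
have [Q [sQS _ cQ]] := normal_pgroup pS (normal_refl S) (ltnW lt_i).
apply/nsn_orderP; exists Q => //.
have sQG := subset_trans sQS sSG; apply: (pgroup_nsn sQG (pgroupS sQS pS)).
  by rewrite -cardG_gt1 cQ -{1}(expn0 p) ltn_exp2l ?prime_gt1.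
apply: contraL lt_i => /card_Hall; rewrite (card_Hall sylS) logn_part cQ p_part.
by move/eqP; rewrite eqn_exp2l ?prime_gt1 // => /eqP->; rewrite ltnn.
Qed.

End SmallCount.

(** An element outside the only maximal subgroup generates the group. *)
Lemma unique_maximal_cyclic (gT : finGroupType) (S : {group gT}) :
    (forall M N : {group gT}, maximal M S -> maximal N S -> M :=: N) ->
  cyclic S.
Proof.
move=> uniqM; have [<- | [M maxM _]] := maximal_exists (sub1G S).
  exact: cyclic1.
have /properP[_ [x Sx M'x]] := maxgroupp maxM.
have sxS : <[x]> \subset S by rewrite cycle_subG.
have [<- | [N maxN]] := maximal_exists sxS; first exact: cycle_cyclic.
by rewrite (uniqM N M maxN maxM) cycle_subG (negPf M'x).
Qed.

Lemma noncyclic_p2_abelem (gT : finGroupType) p (S : {group gT}) :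
  prime p -> #|S| = (p ^ 2)%N -> ~~ cyclic S -> p.-abelem S.
Proof.
move=> p_pr cS ncS; rewrite abelemE // (card_p2group_abelian p_pr cS) /=.
apply/exponentP=> x Sx; apply/eqP; rewrite -order_dvdn.
have: #[x] %| p ^ 2 by rewrite -cS order_dvdG.
case/(dvdn_pfactor _ _ p_pr) => [[|[|[|]]]] // _ ox; rewrite ox ?expn1 //.
case/cyclicP: ncS; exists x; apply/esym/eqP.
by rewrite eqEcard cycle_subG Sx -orderE ox cS leqnn.
Qed.

(** * Factoring the order of the group by its least prime divisor *)

Section Structure.

Variables (gT : finGroupType) (G : {group gT}).
Hypotheses (nsolG : ~~ solvable G) (D4 : D_count G = 4).
Local Notation nsn := (nonselfnorm_subgroups G).
Variable p : nat.
(** An equation rather than a definition, so that [p] can be instantiated by 2 once [pdiv_eq2] is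
    known. *)
Hypothesis pE : p = pdiv #|G|.

Let ntG : 1 < #|G|.
Proof. by rewrite cardG_gt1; apply: contraNneq nsolG => ->; apply: solvable1. Qed.

Let p_pr : prime p. Proof. by rewrite pE pdiv_prime. Qed.
Let p_dv_G : p %| #|G|. Proof. by rewrite pE pdiv_dvd. Qed.

Lemma pdiv_Sylow_noncyclic (S : {group gT}) : p.-Sylow(G) S -> ~~ cyclic S.
Proof.
move=> sylS; apply: contra (Sylow_norm_not_central nsolG D4 p_pr p_dv_G sylS).
by apply: cyclic_Sylow_pdiv_central; rewrite -pE.
Qed.

Lemma pdiv_sqr_dvdG : p ^ 2 %| #|G|.
Proof.
have [S sylS] := Sylow_exists p G; have cS := card_Hall sylS.
rewrite pfactor_dvdn ?cardG_gt0 // ltnNge.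
apply: contra (pdiv_Sylow_noncyclic sylS) => le1; rewrite p_part in cS.
move: le1 cS; case: logn => [|[|]] // _ cS.
  by rewrite (card1_trivg cS) cyclic1.
by rewrite prime_cyclic // cS expn1.
Qed.

Lemma two_more_primes : exists q r,
  [/\ prime q, prime r, q %| #|G|, r %| #|G| & uniq [:: p; q; r]].
Proof.
have := contra (@Burnside_p_a_q_b _ G) nsolG; rewrite -ltnNge => gt2.
have pP : p \in primes #|G| by rewrite mem_primes p_pr cardG_gt0.
have Ur := primes_uniq #|G|; have memr := mem_rem_uniq p Ur.
have := size_rem pP; have := rem_uniq p Ur; case: rem memr => [|q [|r s]] memr /=.
- by move=> _; case: (size (primes _)) gt2 => [|[|[|]]].
- by move=> _; case: (size (primes _)) gt2 => [|[|[|]]].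
have := memr q; have := memr r; rewrite !inE !eqxx orbT !mem_primes cardG_gt0 /=.
move=> /esym/and3P[rp r_pr r_dv] /esym/and3P[qp q_pr q_dv] /andP[+ _] _.
rewrite negb_or => /andP[qr _]; exists q, r; split=> //=.
by rewrite !inE negb_or eq_sym qp eq_sym rp qr.
Qed.

Section TwoPrimes.

Variables q r : nat.
Hypotheses (q_pr : prime q) (r_pr : prime r).
Hypotheses (q_dv_G : q %| #|G|) (r_dv_G : r %| #|G|) (Upqr : uniq [:: p; q; r]).
(** Four orders for four classes: the list is complete and each order has a single class. *)
Let s := [:: p; (p ^ 2)%N; q; r].

Let prime_pow t i : prime t -> 1 < i -> (t ^ i)%N \in s -> t = p /\ i = 2.
Proof.
move=> t_pr i_gt1; have npr u : prime u -> ((t ^ i)%N == u) = false.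
  move=> u_pr; apply: contraTF u_pr => /eqP <-; apply/negP=> pr_ti.
  have := dvdn_exp (ltnW i_gt1) (dvdnn t).
  rewrite dvdn_prime2 // -{1}(expn1 t) eqn_exp2l ?prime_gt1 // => /eqP i1.
  by rewrite -i1 in i_gt1.
rewrite !inE (npr p) // (npr q) // (npr r) //= !orbF => /eqP e.
have tp : t = p.
  apply/eqP; rewrite -dvdn_prime2 //.
  have: t %| p ^ 2 by rewrite -e dvdn_exp // ltnW.
  by rewrite Euclid_dvdX // andbT.
by split=> //; move: e => /eqP; rewrite tp eqn_exp2l ?prime_gt1 // => /eqP->.
Qed.

Lemma nsn_orders_uniq : uniq s.
Proof.
have p2 u : prime u -> ((p ^ 2)%N == u) = false.
  move=> u_pr; apply/eqP=> e; have pu : p = u.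
    by apply/eqP; rewrite -dvdn_prime2 // -e dvdn_exp.
  by move/eqP: e; rewrite -pu -{2}(expn1 p) eqn_exp2l ?prime_gt1.
move: Upqr; rewrite /= !inE !negb_or (eq_sym p (p ^ 2)%N) !p2 //=.
Qed.

Lemma nsn_orders_all : all (nsn_order G) s.
Proof.
have small t : prime t -> t %| #|G| -> nsn_order G t.
  move=> t_pr; rewrite -{1 2}(expn1 t).
  by move/(nsn_order_small_pgroup nsolG D4 t_pr)->.
rewrite /= (small p) // (small q) // (small r) //= andbT.
by rewrite (nsn_order_small_pgroup nsolG D4 p_pr) ?pdiv_sqr_dvdG.
Qed.

Lemma nsn_order_mem n : nsn_order G n -> n \in s.
Proof.
case/nsn_orderP=> H nH <-.
by apply: D_count_orders nsn_orders_uniq nsn_orders_all _ nH; rewrite D4.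
Qed.

Lemma nsn_conj (H K : {group gT}) :
  H \in nsn -> K \in nsn -> #|H| = #|K| -> exists2 x, x \in G & K :=: H :^ x.
Proof. by apply: D_count_conj nsn_orders_uniq nsn_orders_all _; rewrite D4. Qed.

Lemma prime_dvdG_mem t : prime t -> t %| #|G| -> t \in [:: p; q; r].
Proof.
move=> t_pr t_dv_G; have: t \in s.
  apply: nsn_order_mem; rewrite -(expn1 t).
  by apply: (nsn_order_small_pgroup nsolG D4); rewrite ?expn1.
rewrite !inE => /or4P[->|/eqP e|->|->]; rewrite ?orbT //.
have : t %| p ^ 2 by rewrite e.
by rewrite Euclid_dvdX // andbT dvdn_prime2 // => ->.
Qed.

Lemma logn_neq_pdiv_le1 t : prime t -> t != p -> logn t #|G| <= 1.
Proof.
move=> t_pr; rewrite leqNgt -pfactor_dvdn ?cardG_gt0 //; apply: contra => t2.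
have /nsn_order_mem : nsn_order G (t ^ 2).
  exact: (nsn_order_small_pgroup nsolG D4).
by case/prime_pow=> // ->.
Qed.

(* If |S| = p^3 then S is self-normalizing, and its maximal subgroups, being
   normal in S and conjugate in G, are equal by fusion. *)
Lemma logn_pdiv_eq2 : logn p #|G| = 2.
Proof.
apply/eqP; rewrite eqn_leq -pfactor_dvdn // pdiv_sqr_dvdG andbT.
rewrite leqNgt; apply/negP=> gt2.
have [S sylS] := Sylow_exists p G; have [sSG pS _] := and3P sylS.
(* If [p ^ 4] divided the order, a non-Sylow subgroup of order [p ^ 3] would give a fifth order. *)
have le3 : logn p #|G| <= 3.
  rewrite leqNgt -pfactor_dvdn //; apply/negP=> /(nsn_order_pgroup_proper p_pr) n3.
  by have /prime_pow[] : (p ^ 3)%N \in s by apply: nsn_order_mem; apply: n3.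
have cS : #|S| = (p ^ 3)%N.
  rewrite (card_Hall sylS) p_part; congr (p ^ _)%N; apply/eqP.
  by rewrite eqn_leq le3.
have ntS : S :!=: 1 by rewrite -cardG_gt1 cS -{1}(expn0 p) ltn_exp2l ?prime_gt1.
have NS : 'N_G(S) = S.
  apply/eqP; apply/negPn/negP=> nNS.
  have /prime_pow[] // : (p ^ 3)%N \in s.
  by apply: nsn_order_mem; apply/nsn_orderP; exists S; rewrite // !inE sSG ntS.
case/negP: (pdiv_Sylow_noncyclic sylS).
apply: unique_maximal_cyclic => M N maxM maxN.
have maxE (L : {group gT}) : maximal L S ->
    [/\ S \subset 'N(L), #|L| = (p ^ 2)%N & L \in nsn].
  move=> maxL; have nsLS := p_maximal_normal pS maxL.
  have sLS := normal_sub nsLS.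
  have cL : #|L| = (p ^ 2)%N.
    have := Lagrange sLS; rewrite (p_maximal_index pS maxL) cS (expnSr p 2).
    by move/eqP; rewrite eqn_pmul2r ?prime_gt0 // => /eqP.
  split=> //; first exact: normal_norm.
  apply: (pgroup_nsn (subset_trans sLS sSG) (pgroupS sLS pS)).
    by rewrite -cardG_gt1 cL -{1}(expn0 p) ltn_exp2l ?prime_gt1.
  apply/negP=> /card_Hall; rewrite -(card_Hall sylS) cL cS => /eqP.
  by rewrite eqn_exp2l ?prime_gt1.
have [nMS cM nM] := maxE M maxM; have [nNS cN nN] := maxE N maxN.
have [x Gx defN] := nsn_conj nM nN (etrans cM (esym cN)).
rewrite defN in nNS; have [n] := Sylow_fusion sylS Gx nMS nNS.
by rewrite NS -defN => /(subsetP nMS)/normP->.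
Qed.

(** The [p + 1] subgroups of order [p] in the elementary abelian group [S] form one class in [G];
    being normal in [S], they are fused already by ['N_G(S)], so they form an orbit of it. *)
Lemma pdiv_succ_dvd_normS (S : {group gT}) : p.-Sylow(G) S -> p.+1 %| #|'N_G(S)|.
Proof.
move=> sylS; have [sSG pS _] := and3P sylS.
have cS : #|S| = (p ^ 2)%N by rewrite (card_Hall sylS) p_part logn_pdiv_eq2.
have abS := noncyclic_p2_abelem p_pr cS (pdiv_Sylow_noncyclic sylS).
have E2S : S \in 'E_p^2(S) by apply/pnElemP; rewrite cS pfactorK.
rewrite -(card_p1Elem_p2Elem E2S).
have E1P (X : {group gT}) :
    X \in 'E_p^1(S) -> [/\ X \subset S, S \subset 'N(X), #|X| = p & X \in nsn].
  move=> E1X; have cX := card_p1Elem E1X; have [sXS _ _] := pnElemP E1X.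
  split=> //.
    by rewrite sub_abelian_norm // (abelem_abelian abS).
  apply: (pgroup_nsn (subset_trans sXS sSG) (pgroupS sXS pS)).
    by rewrite -cardG_gt1 cX prime_gt1.
  apply/negP=> /card_Hall; rewrite -(card_Hall sylS) cX cS => /eqP.
  by rewrite -{1}(expn1 p) eqn_exp2l ?prime_gt1.
have [X0 E1X0] : exists X, X \in 'E_p^1(S).
  by apply/set0Pn; rewrite -card_gt0 (card_p1Elem_p2Elem E2S).
suff -> : 'E_p^1(S) = orbit 'JG 'N_G(S) X0 by apply: dvdn_orbit.
have [sX0 nX0 cX0 n0] := E1P X0 E1X0.
apply/setP=> X; apply/idP/orbitP=> [E1X | [n /setIP[Gn Nn] <-]].
  have [sX nX cX nnX] := E1P X E1X.
  have [x Gx defX] := nsn_conj n0 nnX (etrans cX0 (esym cX)).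
  rewrite defX in nX; have [n Nn defn] := Sylow_fusion sylS Gx nX0 nX.
  by exists n => //; apply: group_inj; rewrite /= defn.
rewrite p1ElemE // !inE in E1X0 *; rewrite /= cardJg cX0 eqxx andbT.
by rewrite -(normP Nn) conjSg.
Qed.

(** A prime divisor of [p + 1] divides [#|G|], so it is at least [p] and must be [p + 1] itself; of
    two consecutive primes, the smaller is 2. *)
Lemma pdiv_eq2 : p = 2.
Proof.
have [S sylS] := Sylow_exists p G; have p1_dv := pdiv_succ_dvd_normS sylS.
have p1_dv_G : p.+1 %| #|G| by apply: dvdn_trans p1_dv _; rewrite cardSg ?subsetIl.
set t := pdiv p.+1; have t_pr : prime t by rewrite pdiv_prime // ltnS prime_gt0.
have t_dv : t %| p.+1 := pdiv_dvd _.
have t_ge : p <= t.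
  rewrite pE; exact: pdiv_min_dvd (prime_gt1 t_pr) (dvdn_trans t_dv p1_dv_G).
have t_le : t <= p.+1 by apply: dvdn_leq.
have tp : t = p.+1.
  move: t_ge; rewrite leq_eqVlt => /orP[/eqP e | lt]; last first.
    by apply/eqP; rewrite eqn_leq t_le.
  move: t_dv; rewrite -e -addn1 dvdn_addr // dvdn1 => /eqP p1.
  by have := p_pr; rewrite p1.
have := p_pr; have := t_pr; rewrite tp => /even_prime[[p1]|]; first by rewrite p1.
by rewrite /= => evp /even_prime[] // odp; rewrite odp in evp.
Qed.

Lemma card_pdiv_sqr_qr : #|G| = (p ^ 2 * (q * r))%N.
Proof.
have [p0 q0 r0] : [/\ 0 < p, 0 < q & 0 < r] by rewrite !prime_gt0.
have [] := and3P Upqr; rewrite !inE negb_or => /andP[npq npr] nqr _.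
have [nqp nrp] : q != p /\ r != p by rewrite eq_sym npq eq_sym.
have log1 t : prime t -> t %| #|G| -> t != p -> logn t #|G| = 1%N.
  move=> t_pr t_dv ntp; apply/eqP; rewrite eqn_leq logn_neq_pdiv_le1 //=.
  by rewrite logn_gt0 mem_primes t_pr cardG_gt0.
apply: eqn_from_log; rewrite ?muln_gt0 ?expn_gt0 ?cardG_gt0 ?p0 ?q0 // => t /=.
have [t_pr | t_npr] := boolP (prime t); last first.
  by rewrite [LHS]lognE [RHS]lognE (negPf t_npr).
rewrite lognM ?muln_gt0 ?expn_gt0 ?p0 ?q0 // lognX lognM //.
rewrite (logn_prime t p_pr) (logn_prime t q_pr) (logn_prime t r_pr).
have [-> | ntp] := eqVneq t p.
  by rewrite logn_pdiv_eq2 (negPf npq) (negPf npr).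
have [-> | ntq] := eqVneq t q; first by rewrite log1 // (negPf nqr).
have [-> | ntr] := eqVneq t r; first by rewrite log1.
apply/eqP; rewrite muln0 -leqn0 leqNgt logn_gt0 mem_primes t_pr cardG_gt0 /=.
apply/negP=> /(prime_dvdG_mem t_pr).
by rewrite !inE (negPf ntp) (negPf ntq) (negPf ntr).
Qed.

End TwoPrimes.

End Structure.

(** * Recognizing the alternating group by a subgroup of index 5 *)

(** Right multiplication on the numbered right cosets; an element of the kernel fixes the coset [H],
    hence lies in [H]. *)
Lemma coset_perm_morphism (gT : finGroupType) (G H : {group gT}) n :
    H \subset G -> #|G : H| = n ->
  exists f : {morphism G >-> {perm 'I_n}}, 'ker f \subset H.
Proof.
move=> sHG <-; rewrite /indexg; set A := rcosets H G.
have AH : gval H \in A by apply/rcosetsP; exists 1; rewrite ?group1 ?mulg1.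
have AJ B x : B \in A -> x \in G -> B :* x \in A.
  case/rcosetsP=> y Gy -> Gx; apply/rcosetsP.
  by exists (y * x); rewrite ?groupM ?rcosetM.
(* The identity outside [G] is a default that keeps [g x] injective for every [x], as [perm]
   requires. *)
pose g x (i : 'I_#|A|) :=
  if x \in G then enum_rank_in AH (enum_val i :* x) else i.
have gE x i : x \in G -> enum_val (g x i) = enum_val i :* x.
  by move=> Gx; rewrite /g Gx enum_rankK_in ?AJ ?enum_valP.
have g_inj x : injective (g x).
  have [Gx i j eq_g | G'x i j] := boolP (x \in G); last by rewrite /g (negPf G'x).
  apply: enum_val_inj; apply: (can_inj (rcosetK x)).
  by rewrite /= -!gE // eq_g.
have fM : {in G &, {morph (fun x => perm (@g_inj x)) : x y / x * y}}.
  move=> x y Gx Gy; apply/permP=> i; rewrite permM !permE.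
  by apply: enum_val_inj; rewrite !gE ?groupM // rcosetM.
exists (Morphism fM); apply/subsetP=> x kx; have Gx := dom_ker kx.
have := congr1 (fun u : {perm 'I_#|A|} => u (enum_rank_in AH (gval H))) (mker kx).
rewrite /= permE perm1 => /(congr1 enum_val); rewrite gE // enum_rankK_in //.
by move=> <-; rewrite rcoset_refl.
Qed.

Lemma order60_index5_isog (gT : finGroupType) (G H : {group gT}) :
    simple G -> #|G| = 60 -> H \subset G -> #|G : H| = 5 ->
  G \isog 'Alt_('I_5).
Proof.
move=> /simpleP[_ simG] cG sHG iH.
have [f kerf] := coset_perm_morphism sHG iH.
have injf : 'injm f.
  case: (simG _ (ker_normal f)) => [-> // | kG]; move: kerf.
  by rewrite kG -indexg_eq1 iH.
have cfG : #|f @* G| = 60 by rewrite card_injm.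
have cAlt : #|'Alt_('I_5)| = 60.
  by apply/eqP; rewrite -(eqn_pmul2l (isT : 0 < 2)) card_Alt card_ord.
suff <- : f @* G = 'Alt_('I_5) by apply: sub_isog.
apply/eqP; rewrite eqEcard cAlt cfG leqnn andbT.
have nB : f @* G :&: 'Alt_('I_5) <| f @* G.
  by apply: normalGI (Alt_normal _); apply: subsetT.
have [] := simG (f @*^-1 (f @* G :&: 'Alt_('I_5)))%G.
- rewrite -[X in _ <| X](morphimGK (subset_trans kerf sHG) (subxx G)).
  by rewrite morphpre_normal ?subsetIl.
- move=> /= K1.
  have ti : f @* G :&: 'Alt_('I_5) = 1.
    by rewrite -(morphpreK (subsetIl _ _)) K1 morphim1.
  (* A trivial intersection would give a product set of 3600 elements among 120 permutations. *)
  have := max_card (mem (f @* G * 'Alt_('I_5))).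
  by rewrite TI_cardMg // cfG cAlt card_Sn.
move=> /= /(congr1 (fun A => f @* A)).
by rewrite morphpreK ?subsetIl // => /setIidPl.
Qed.

(** * Order 60, simplicity and the subgroup of index 5 *)

Section Main.

Variables (gT : finGroupType) (G : {group gT}).
Hypotheses (nsolG : ~~ solvable G) (D4 : D_count G = 4).
Local Notation nsn := (nonselfnorm_subgroups G).

Lemma Sylow2_norm : exists2 S : {group gT}, 2.-Sylow(G) S & 3 %| #|'N_G(S)|.
Proof.
have [q [r [q_pr r_pr q_dv r_dv Upqr]]] :=
  two_more_primes nsolG (erefl (pdiv #|G|)).
have p2 := pdiv_eq2 nsolG D4 (erefl _) q_pr r_pr q_dv r_dv Upqr.
have [S sylS] := Sylow_exists 2 G; exists S => //.
by apply: (pdiv_succ_dvd_normS nsolG D4 _ q_pr r_pr q_dv r_dv _ sylS); rewrite -?p2.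
Qed.

Lemma D4_order_12r : exists r,
  [/\ prime r, r \notin [:: 2; 3], #|G| = (12 * r)%N, nsn_order G r
    & forall n, nsn_order G n -> n \in [:: 2; 4; 3; r]].
Proof.
have [q [r [q_pr r_pr q_dv r_dv Upqr]]] :=
  two_more_primes nsolG (erefl (pdiv #|G|)).
have p2 := pdiv_eq2 nsolG D4 (erefl _) q_pr r_pr q_dv r_dv Upqr.
have pE : 2 = pdiv #|G| by rewrite p2.
rewrite p2 in Upqr.
have [S _ d3] := Sylow2_norm.
have d3G : 3 %| #|G| by apply: dvdn_trans d3 _; rewrite cardSg ?subsetIl.
have := prime_dvdG_mem nsolG D4 pE q_pr r_pr q_dv r_dv Upqr (isT : prime 3) d3G.
have cG := card_pdiv_sqr_qr nsolG D4 pE q_pr r_pr q_dv r_dv Upqr.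
have mem := nsn_order_mem nsolG D4 pE q_pr r_pr q_dv r_dv Upqr.
have := nsn_orders_all nsolG D4 pE q_pr r_pr q_dv r_dv.
rewrite /= => /and5P[_ _ nq nr _].
move: Upqr; rewrite /= !inE !negb_or andbT /= => /andP[/andP[nq2 nr2] nqr].
(* The prime 3 is [q] or [r]; the other one is the witness. *)
case/orP=> /eqP e3; [exists r | exists q]; move: cG mem nqr;
  rewrite -e3 => cG mem nqr.
- split=> //; first by rewrite !inE negb_or eq_sym nr2 eq_sym.
  by rewrite cG mulnA.
- split=> //; first by rewrite !inE negb_or eq_sym nq2.
    by rewrite cG mulnCA mulnC mulnAC.
  by move=> n /mem; rewrite !inE => /or4P[] ->; rewrite ?orbT.
Qed.

(** [R] is a Sylow [r]-subgroup and not self-normalizing, so the number [n] of its conjugates is a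
    proper divisor of 12, at most 6. It is congruent to 1 modulo [r] and not 1, so [r < n] and only
    [r = 5] remains. *)
Lemma D4_card60 : #|G| = 60.
Proof.
have [r [r_pr r_n23 cG /nsn_orderP[R nR cR] _]] := D4_order_12r.
have r_gt0 := prime_gt0 r_pr.
have [nr2 nr3] : r != 2 /\ r != 3.
  by apply/andP; move: r_n23; rewrite !inE negb_or.
have r_co12 : coprime r 12.
  rewrite -[12]/(2 ^ 2 * 3)%N coprimeMr coprime_pexpr // !prime_coprime //.
  by rewrite !dvdn_prime2 // nr2 nr3.
have [sRG _ nNR] : [/\ R \subset G, R :!=: 1 & 'N_G(R) != R].
  by apply/and3P; rewrite !inE in nR.
have sylR : r.-Sylow(G) R.
  have r12 : (12`_r = 1)%N by apply: part_p'nat; rewrite p'natE // -prime_coprime.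
  by rewrite pHallE sRG cG cR partnM // r12 mul1n part_pnat_id ?pnat_id /=.
have := card_Syl_mod G r_pr; rewrite (card_Syl sylR).
set n := #|G : _| => n_mod.
have sRN : R \subset 'N_G(R) by rewrite subsetI sRG normG.
have mn : (#|'N_G(R) : R| * n = 12)%N.
  apply/eqP; rewrite -(eqn_pmul2l r_gt0) mulnA -cR Lagrange //.
  by rewrite Lagrange ?subsetIl // cG cR mulnC.
have m_gt1 : 1 < #|'N_G(R) : R|.
  rewrite indexg_gt1; apply: contra nNR => sNR; rewrite eqEsubset sNR sRN //.
have n_neq1 : n != 1%N.
  (* If [R] were normal, the quotient would have order 12 and [G] would be solvable. *)
  rewrite indexg_eq1 subsetI subxx /=; apply: contra nsolG => nRG.
  have nsRG : R <| G by rewrite /normal sRG.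
  rewrite (series_sol nsRG) (pgroup_sol (pHall_pgroup sylR)) /=.
  apply: Burnside_p_a_q_b; rewrite card_quotient // -divgS // cG cR mulnK //.
have n_gt0 : 0 < n by apply: indexg_gt0.
have n_le6 : n <= 6.
  rewrite -(leq_pmul2l (isT : 0 < 2)) -[(2 * 6)%N]mn leq_mul2r m_gt1 orbT //.
have r_lt_n : r < n.
  rewrite ltnNge; apply/negP; rewrite leq_eqVlt => /orP[/eqP e | lt].
    by move: n_mod; rewrite e modnn.
  by move: n_mod n_neq1; rewrite modn_small // => ->.
have r_le5 : r <= 5 by rewrite -ltnS (leq_trans r_lt_n).
move: r_pr r_n23 r_le5 cG.
by case: r {nR cR r_gt0 nr2 nr3 r_co12 sylR n_mod r_lt_n} => [|[|[|[|[|[|]]]]]].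
Qed.

(** A proper nontrivial normal subgroup has one of the orders 2, 4, 3, 5; both it and its quotient
    are then solvable. *)
Lemma D4_simple : simple G.
Proof.
have [r [_ _ cG12 _ mem]] := D4_order_12r; have cG := D4_card60.
have r5 : r = 5 by apply/eqP; rewrite -(eqn_pmul2l (isT : 0 < 12)) -cG12 cG.
rewrite r5 in mem; apply/simpleP; split=> [|K nsKG].
  by rewrite -cardG_gt1 cG.
have [-> | ntK] := eqVneq (gval K) 1; first by left.
have [-> | neqKG] := eqVneq (gval K) G; first by right.
have /mem cK : nsn_order G #|K|.
  by apply/nsn_orderP; exists K; first exact: normal_nsn.
case/negP: nsolG; rewrite (series_sol nsKG); apply/andP; split.
  by apply: Burnside_p_a_q_b; move: cK; rewrite !inE => /or4P[] /eqP->.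
have cQ : #|G / K| = 60 %/ #|K|.
  by rewrite card_quotient ?normal_norm // -divgS ?normal_sub // cG.
(* The quotient of order 30 has three prime divisors, so it is treated by its cyclic Sylow
   subgroups; the orders 15, 20 and 12 have only two. *)
have [cK2 | ncK2] := eqVneq #|K| 2.
  apply/Zgroup_sol/Zgroup_logn=> t t_pr; rewrite cQ cK2.
  rewrite -[60 %/ 2]/(2 * (3 * 5))%N lognM // lognM // !logn_prime //.
  by case: t {t_pr} => [|[|[|[|[|[|]]]]]].
apply: Burnside_p_a_q_b; rewrite cQ; move: cK ncK2.
by rewrite !inE => /or4P[] /eqP->.
Qed.

(** The normalizer of a Sylow 2-subgroup has order divisible by 4 and by 3, so its index divides 5;
    simplicity excludes index 1. *)
Lemma D4_index5 : exists2 H : {group gT}, H \subset G & #|G : H| = 5.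
Proof.
have [S sylS d3] := Sylow2_norm; have cG := D4_card60.
have [_ simG] := simpleP _ D4_simple.
have [sSG pS _] := and3P sylS.
have cS : #|S| = 4.
  by rewrite (card_Hall sylS) cG p_part -[60]/(2 ^ 2 * 15)%N lognM // lognX.
exists 'N_G(S)%G; first exact: subsetIl.
have d12 : 12 %| #|'N_G(S)|.
  rewrite -[12]/(4 * 3)%N Gauss_dvd // d3 andbT -cS cardSg //.
  by rewrite subsetI sSG normG.
have [m cN] := dvdnP d12.
have n_neq1 : #|G : 'N_G(S)| != 1%N.
  rewrite indexg_eq1 subsetI subxx /=; apply/negP=> nSG.
  have nsSG : S <| G by rewrite /normal sSG.
  by case: (simG _ nsSG) => e; move: cS; rewrite e ?cG ?cards1.
have := Lagrange (subsetIl G 'N(S)); rewrite cN cG => e.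
have {e} : (m * #|G : 'N_G(S)| = 5)%N.
  by apply/eqP; rewrite -(eqn_pmul2l (isT : 0 < 12)) mulnA (mulnC 12) e.
move=> e; have: #|G : 'N_G(S)| %| 5 by rewrite -e dvdn_mull.
by move/(prime_nt_dvdP (isT : prime 5) n_neq1).
Qed.

End Main.

Theorem mainTheorem18 (gT : finGroupType) (G : {group gT}) :
  ~~ solvable G -> D_count G = 4 -> G \isog 'Alt_('I_5).
Proof.
move=> nsolG D4; have [H sHG iH] := D4_index5 nsolG D4.
exact: order60_index5_isog (D4_simple nsolG D4) (D4_card60 nsolG D4) sHG iH.
Qed.
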